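(* Let $(G,\mathbb{P})$ be relatively hyperbolic, and let $H\le G$ be a relatively quasiconvex subgroup. Consider the following collection of subgroups of $H$: \[ \bar{\mathbb{O}}:=\{H\cap gPg^{-1} : g\in G,\ P\in\mathbb{P},\text{ and } H\cap gPg^{-1}\text{ is infinite}\}. \] Then the elements of $\bar{\mathbb{O}}$ lie in only finitely many conjugacy classes in $H$. Furthermore, if $\mathbb{O}$ is a set of representatives of these conjugacy classes, then $(H,\mathbb{O})$ is relatively hyperbolic.
   Context: **Relative hyperbolicity.** Let $G$ be a countable group and $\mathbb{P}=\{P_1,\dots,P_n\}$ a finite collection of subgroups. $(G,\mathbb{P})$ is relatively hyperbolic if $G$ acts on a connected graph $K$ (edges of length one) such that: $K$ is $\delta$-hyperbolic for some $\delta$; $K$ is fine, i.e. for each $n$ each edge lies in only finitely many circuits (simple closed edge paths) of length $n$; edge stabilizers are finite; there are finitely many orbits of edges; and $\mathbb{P}$ is a set of representatives of the conjugacy classes of infinite vertex stabilizers. (The paper uses several equivalent definitions; this is one of them.) **Relative quasiconvexity.** A symmetric set $\mathcal{S}\subseteq G$ is a relative generating set for $(G,\mathbb{P})$ if $\mathcal{S}\cup P_1\cup\dots\cup P_n$ generates $G$; a finite one exists when $(G,\mathbb{P})$ is relatively hyperbolic. Let $\mathcal{P}$ be the union of the $P_i$ (nontrivial elements). A metric on $G$ is proper if all its balls are finite. A subgroup $H\le G$ is relatively quasiconvex in $(G,\mathbb{P})$ if for some (equivalently, any) finite relative generating set $\mathcal{S}$ and some (equivalently, any) proper left invariant metric $d$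 on $G$ there is a constant $\kappa$ such that for each geodesic $\bar c$ in $\mathrm{Cayley}(G,\mathcal{S}\cup\mathcal{P})$ (edges of length one) connecting two points of $H$, every vertex of $\bar c$ lies within $d$-distance $\kappa$ of $H$. *)

(* Defs.v *)
From HB Require Import structures.
From mathcomp Require Import all_boot all_order all_algebra.
From mathcomp Require Import all_classical all_reals.
Set Implicit Arguments.
Unset Strict Implicit.
Unset Printing Implicit Defensive.
Import Order.TTheory GRing.Theory Num.Theory.
Local Open Scope classical_set_scope.
Local Open Scope group_scope.

(* A graph is a symmetric irreflexive relation [e] on a type of vertices.  An
   edge path is a first vertex [x] with the sequence [p] of the next vertices
   (as in [path]), so that [size p] is its length when edges have length one. *)
Section Graphs.
Variables (V : eqType) (e : rel V).

Definition simple_graph : Prop := symmetric e /\ irreflexive e.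

(* The empty graph is not connected: otherwise every countable group would be
   hyperbolic relative to the empty collection. *)
Definition graph_connected : Prop :=
  (exists x : V, True) /\
  forall x y : V, exists2 p : seq V, path e x p & last x p = y.

Definition geodesic (x : V) (p : seq V) : Prop :=
  path e x p /\
  forall q : seq V, path e x q -> last x q = last x p -> (size p <= size q)%N.

Definition within (n : nat) (x y : V) : Prop :=
  exists p : seq V, [/\ path e x p, last x p = y & (size p <= n)%N].

(* Geodesic triangles with corners at vertices are uniformly thin.  As x, y, z
   and the three sides are arbitrary and geodesics can be reversed, it is enough
   to bound the side from x to z. *)
Definition hyperbolic : Prop :=
  exists delta : nat, forall (x y z : V) (p q r : seq V),
    geodesic x p -> last x p = y ->
    geodesic y q -> last y q = z ->
    geodesic x r -> last x r = z ->
    forall u : V, u \in x :: r ->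
      exists2 w : V, (w \in x :: p) || (w \in y :: q) & within delta u w.

Definition edges : set (set V) :=
  [set E | exists x y : V, e x y /\ E = [set x; y]].

(* A circuit is given by its vertices in cyclic order.  The choice of a starting
   vertex and of an orientation represents a circuit of length n by 2n such
   sequences.  The bound 2 < n excludes going back and forth along one edge. *)
Definition circuit (n : nat) (c : seq V) : Prop :=
  [/\ (2 < n)%N, size c = n, cycle e c & uniq c].

Definition circuit_edge (c : seq V) (E : set V) : Prop :=
  exists2 x : V, x \in c & E = [set x; next c x].

Definition fine_graph : Prop :=
  forall (n : nat) (E : set V), edges E ->
    finite_set [set c : seq V | circuit n c /\ circuit_edge c E].

End Graphs.

Section Actions.
Variables (G : groupType) (V : eqType) (e : rel V) (act : G -> V -> V).

Definition graph_action : Prop :=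
  [/\ forall v : V, act 1 v = v,
      forall (g h : G) (v : V), act (g * h) v = act g (act h v) &
      forall (g : G) (x y : V), e (act g x) (act g y) = e x y].

Definition vertex_stabilizer (v : V) : set G := [set g | act g v = v].

Definition edge_stabilizer (E : set V) : set G := [set g | act g @` E = E].

Definition edge_orbit (E : set V) : set (set V) :=
  [set act g @` E | g in [set: G]].

Definition infinite_vertex_stabilizers : set (set G) :=
  [set A | (exists v : V, A = vertex_stabilizer v) /\ infinite_set A].

End Actions.

Section RelativeHyperbolicity.
Variable G : groupType.

Definition conj_set (g : G) (A : set G) : set G := [set g * x * g^-1 | x in A].

Definition conj_class (A : set G) : set (set G) :=
  [set conj_set g A | g in [set: G]].

Definition conj_representatives (PP QQ : set (set G)) : Prop :=
  PP `<=` QQ /\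
  forall Q : set G, QQ Q -> exists! P : set G, PP P /\ conj_class P Q.

(* The members of PP are subgroups, being vertex stabilizers. *)
Definition relatively_hyperbolic (PP : set (set G)) : Prop :=
  [/\ countable [set: G], finite_set PP &
    exists (V : eqType) (e : rel V) (act : G -> V -> V),
      [/\ simple_graph e, graph_connected e & graph_action e act] /\
      [/\ hyperbolic e, fine_graph e,
          forall E : set V, edges e E -> finite_set (edge_stabilizer act E),
          finite_set (edge_orbit act @` edges e) &
          conj_representatives PP (infinite_vertex_stabilizers act)]].

End RelativeHyperbolicity.

Section RelativeQuasiconvexity.
Variables (R : realType) (G : groupType).

Definition generates (T : set G) : Prop :=
  forall K : {pred G}, group_closed K ->
    (forall x : G, T x -> x \in K) -> forall x : G, x \in K.

Definition parabolic_elements (PP : set (set G)) : set G :=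
  [set x | x <> 1 /\ exists2 P : set G, PP P & P x].

Definition relative_generating_set (PP : set (set G)) (S : set G) : Prop :=
  (forall x : G, S x -> S x^-1) /\
  generates (S `|` \bigcup_(P in PP) P).

Definition cayley (T : set G) : rel G :=
  [rel x y | (x != y) && (x^-1 * y \in T)].

Definition is_metric (d : G -> G -> R) : Prop :=
  [/\ forall x y : G, (0 <= d x y)%R,
      forall x y : G, d x y = 0%R <-> x = y,
      forall x y : G, d x y = d y x &
      forall x y z : G, (d x z <= d x y + d y z)%R].

Definition left_invariant (d : G -> G -> R) : Prop :=
  forall g x y : G, d (g * x) (g * y) = d x y.

Definition proper_metric (d : G -> G -> R) : Prop :=
  forall (x : G) (r : R), finite_set [set y | (d x y <= r)%R].

Definition relatively_quasiconvex (PP : set (set G)) (H : set G) : Prop :=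
  exists (S : set G) (d : G -> G -> R) (kappa : R),
    [/\ finite_set S, relative_generating_set PP S,
        [/\ is_metric d, left_invariant d & proper_metric d] &
        forall (x : G) (p : seq G),
          geodesic (cayley (S `|` parabolic_elements PP)) x p ->
          H x -> H (last x p) ->
          forall v : G, v \in x :: p -> exists2 h : G, H h & (d v h <= kappa)%R].

End RelativeQuasiconvexity.

(* [H] is the subgroup with carrier [D], regarded as a group in its own right,
   and [val] is its inclusion in G. *)
Definition infinite_parabolics (G : groupType) (D : pred G)
    (H : subGroupType D) (PP : set (set G)) : set (set H) :=
  [set A | (exists (g : G) (P : set G),
              PP P /\ A = [set h : H | conj_set g P (val h)]) /\
           infinite_set A].
Arguments infinite_parabolics {G D} H PP.

(* Main.v *)
Require Import Defs.
From mathcomp Require Import all_boot all_order all_algebra.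
From mathcomp Require Import all_classical all_reals.
From mathcomp Require Import zify.
Import Defs.
Set Implicit Arguments.
Unset Strict Implicit.
Unset Printing Implicit Defensive.
Local Open Scope classical_set_scope.

(** Let K be a fine hyperbolic graph on which G acts as in the definition of
    relative hyperbolicity, and v0 a vertex of K.  The plan is to find inside K
    a connected H-invariant subgraph L that is quasi-isometrically embedded and
    has finitely many H-orbits of edges.  Such an L witnesses the relative
    hyperbolicity of H: fineness and finiteness of edge stabilizers pass to
    subgraphs, hyperbolicity passes along quasi-isometric embeddings, and the
    infinite vertex stabilizers of H in L turn out to be exactly the infinite
    subgroups H meets gPg^-1.  As every vertex of L is an H-translate of one of
    finitely many vertices, these subgroups form finitely many conjugacy
    classes of H.

    The subgraph L consists of the edges of K with both ends in one translate
    hF of a finite set F of vertices, restricted to the connected component of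
    v0 ([hull_edge], [hull]).  Quasiconvexity says how to choose F
    ([quasiconvex_orbit_embedding]).  A geodesic from 1 to h in the relative
    Cayley graph stays in HB for a finite ball B, so it is shadowed by a
    sequence of elements of H.  If a step of the geodesic is a generator in S,
    the corresponding step in H lies in the finite set BSB^-1; if it is an
    element of P, the two elements of H are h and k with hbP = kcP for some b, c
    in B, and the vertex of K fixed by hbPb^-1h^-1 is reached from h.v0 and from
    k.v0 by translates of finitely many paths ([cayley_path_shadow]).  With
    these paths in F, distances in L between points of the orbit H.v0 are at
    most linear in the relative word length, and the latter is at most linear
    in the distance in K, because the elements that move one vertex of a finite
    set to another form a coset of a vertex stabilizer, on which the relative
    length is bounded ([relative_length_le_orbit_distance]).

    Hyperbolicity of L is the stability of quasigeodesics in hyperbolic graphs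
    ([thin_triangles_pullback]).  Finally, a vertex x of K outside L has a
    finite stabilizer in H ([finite_stabilizer_outside_hull]): take a simple
    path from x to v0 with first edge xu; for h in H fixing x, this path, a path
    of L from v0 to h.v0 and the h-translate of the first path join u to h.u
    without meeting x, and have bounded total length, so by fineness there are
    finitely many vertices h.u, and each determines h up to the finite
    stabilizer of an edge. *)

(** * Walks and geodesics *)

Section Walks.
Local Open Scope nat_scope.
Variables (V : eqType) (e : rel V).
Implicit Types (x y z u v w : V) (p q r s c : seq V) (m n : nat).

Lemma within_refl n x : within e n x x.
Proof. by exists [::]. Qed.

Lemma within_leq m n x y : m <= n -> within e m x y -> within e n x y.
Proof. by move=> mn [p [ep lp sp]]; exists p; split=> //; lia. Qed.

Lemma within_trans m n x y z :
  within e m x y -> within e n y z -> within e (m + n) x z.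
Proof.
move=> [p [ep lp sp]] [q [eq lq sq]]; exists (p ++ q).
by rewrite cat_path last_cat size_cat lp ep eq lq; split=> //; lia.
Qed.

Lemma path_within x p : path e x p -> within e (size p) x (last x p).
Proof. by move=> ep; exists p. Qed.

Lemma walk_rev x p : symmetric e -> path e x p ->
  exists q, [/\ path e (last x p) q, last (last x p) q = x,
                size q = size p & last x p :: q =i x :: p].
Proof.
move=> es ep; exists (rev (belast x p)); split.
- by rewrite rev_path; under eq_path do rewrite es.
- by case: p {ep} => //= y p; rewrite rev_cons last_rcons.
- by rewrite size_rev size_belast.
- by move=> z; rewrite [x :: p]lastI -rev_rcons mem_rev.
Qed.

Lemma within_sym n x y : symmetric e -> within e n x y -> within e n y x.
Proof.
move=> es [p [ep <- sp]]; have [q [eq lq sq _]] := walk_rev es ep.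
by exists q; rewrite sq.
Qed.

Lemma path_mem_within x p u : symmetric e -> path e x p -> u \in x :: p ->
  within e (size p) u x /\ within e (size p) x u.
Proof.
move=> es ep up; suff w : within e (size p) x u.
  by split=> //; apply: within_sym.
move: ep; case/splitPl: up => p1 p2 <-; rewrite cat_path => /andP[ep _].
by apply: within_leq (path_within ep); rewrite size_cat; lia.
Qed.

Lemma geodesic_leq n x p : geodesic e x p -> within e n x (last x p) ->
  size p <= n.
Proof. by move=> [_ g] [q [eq lq sq]]; apply: leq_trans (g q eq lq) sq. Qed.

Lemma geodesic_exists n x y : within e n x y ->
  exists p, geodesic e x p /\ last x p = y.
Proof.
move=> w; have ex : exists n, `[< within e n x y >] by exists n; apply/asboolP.
case: (ex_minnP ex) => m /asboolP[p [ep lp sp]] min; exists p; split=> //.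
split=> // q eq lq; apply: leq_trans sp _; apply: min; apply/asboolP.
by exists q; split; rewrite ?lq.
Qed.

Lemma geodesic_catl x p q : geodesic e x (p ++ q) -> geodesic e x p.
Proof.
move=> [+ g]; rewrite cat_path => /andP[ep eq]; split=> // r er lr.
have := g (r ++ q); rewrite cat_path !last_cat er lr eq !size_cat => /(_ isT erefl).
by lia.
Qed.

Lemma geodesic_catr x p q : geodesic e x (p ++ q) -> geodesic e (last x p) q.
Proof.
move=> [+ g]; rewrite cat_path => /andP[ep eq]; split=> // r er lr.
have := g (p ++ r); rewrite cat_path !last_cat er lr ep !size_cat => /(_ isT erefl).
by lia.
Qed.

Lemma geodesic_rev x p : symmetric e -> geodesic e x p ->
  exists q, [/\ geodesic e (last x p) q, last (last x p) q = x &
                last x p :: q =i x :: p].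
Proof.
move=> es gp; have [q [eq lq sq qp]] := walk_rev es gp.1.
exists q; split=> //; split=> // r er lr; rewrite sq.
apply: (geodesic_leq gp); apply: within_sym => //; exists r; split=> //.
by rewrite lr.
Qed.

Lemma geodesic_between x c a b : symmetric e -> geodesic e x c ->
  a \in x :: c -> b \in x :: c ->
  exists s, [/\ geodesic e a s, last a s = b & {subset a :: s <= x :: c}].
Proof.
move=> es + ac; case/splitPl: ac => c1 c2 la gc.
rewrite -cat_cons mem_cat => /orP[] bc.
  move: la gc; case/splitPl: bc => d1 d2 lb la gc.
  have := geodesic_catr (geodesic_catl gc); rewrite lb => gd.
  have [q [gq lq qd]] := geodesic_rev es gd.
  have ea : last b d2 = a by rewrite -la last_cat lb.
  rewrite ea in gq lq qd; exists q; split=> // z; rewrite qd inE => /predU1P[->|].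
    by rewrite -lb mem_cat -cat_cons mem_cat mem_last.
  by move=> zd; rewrite mem_cat inE mem_cat zd !orbT.
have {bc} : b \in a :: c2 by rewrite inE bc orbT.
have := geodesic_catr gc; rewrite la => ga bc.
move: ga gc; case/splitPl: bc => d1 d2 lb /geodesic_catl ga gc.
exists d1; split=> // z; rewrite inE => /predU1P[->|zd].
  by rewrite mem_cat -la mem_last.
by rewrite !mem_cat zd !orbT.
Qed.

Definition thin_triangles (delta : nat) : Prop :=
  forall (x y z : V) (p q r : seq V),
    geodesic e x p -> last x p = y ->
    geodesic e y q -> last y q = z ->
    geodesic e x r -> last x r = z ->
    forall u : V, u \in x :: r ->
      exists2 w : V, (w \in x :: p) || (w \in y :: q) & within e delta u w.

(** Bisecting the path [c] and applying thinness to the triangle formed by the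
    ends and the middle vertex costs [delta] and halves the length, hence a
    bound that is logarithmic in the length of [c].  This is where
    quasigeodesics are forced to stay close to geodesics. *)
Lemma geodesic_near_path delta k x c r u : thin_triangles delta ->
  path e x c -> size c <= 2 ^ k -> geodesic e x r -> last x r = last x c ->
  u \in x :: r -> exists2 w, w \in x :: c & within e (delta * k) u w.
Proof.
move=> thin; elim: k x c r u => [|k IH] x c r u ec sc gr lr ur.
  have sr : size r <= 1 by apply: leq_trans (gr.2 c ec (esym lr)) sc.
  exists u; last exact: within_refl.
  move: ur lr; case: r sr {gr} => [|y [|//]] _ /=.
    by rewrite inE => /eqP-> _; rewrite mem_head.
  rewrite !inE => /orP[/eqP->|/eqP->] lr; first by rewrite eqxx.
  by rewrite lr -in_cons mem_last.
pose c1 := take (2 ^ k) c; pose c2 := drop (2 ^ k) c.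
have c12 : c1 ++ c2 = c by apply: cat_take_drop.
have sc1 : size c1 <= 2 ^ k by rewrite size_take; case: ltnP.
have sc2 : size c2 <= 2 ^ k by rewrite size_drop; move: sc; rewrite expnS; lia.
rewrite -c12 cat_path in ec; have /andP[ec1 ec2] := ec.
have [p [gp lp]] := geodesic_exists (path_within ec1).
have [q [gq lq]] := geodesic_exists (path_within ec2).
have lq' : last (last x c1) q = last x r by rewrite lr lq -c12 last_cat.
have [w /orP[wp|wq] uw] := thin _ _ _ _ _ _ gp lp gq lq' gr erefl u ur.
  have [w' w'c ww'] := IH _ _ _ _ ec1 sc1 gp lp wp.
  exists w'; first by rewrite -c12 -cat_cons mem_cat w'c.
  by rewrite mulnS; apply: within_trans uw ww'.
have [w' w'c ww'] := IH _ _ _ _ ec2 sc2 gq lq wq.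
exists w'; last by rewrite mulnS; apply: within_trans uw ww'.
move: w'c; rewrite -c12 -cat_cons mem_cat inE => /predU1P[->|->]; last by rewrite orbT.
by rewrite mem_last.
Qed.

(** A discrete connectedness argument: two sets that cover a path and contain
    its first and its last vertex respectively come within distance one. *)
Lemma path_crossing (P Q : V -> Prop) x p : path e x p ->
  (forall u, u \in x :: p -> P u \/ Q u) -> P x -> Q (last x p) ->
  exists w w', [/\ w \in x :: p, P w, Q w' & within e 1 w w'].
Proof.
elim: p x => [|y p IH] x /= ep PQ Px Ql.
  by exists x, x; rewrite mem_head; split=> //; apply: within_refl.
have /andP[xy yp] := ep.
have [Py|Qy] : P y \/ Q y by apply: PQ; rewrite !inE eqxx orbT.
  have [|w [w' [wp Pw Qw ww]]] := IH y yp _ Py Ql.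
    by move=> u up; apply: PQ; rewrite inE up orbT.
  by exists w, w'; split=> //; rewrite inE wp orbT.
exists x, y; split=> //; first by rewrite mem_head.
by exists [:: y]; rewrite /= xy.
Qed.

End Walks.

(** * Stability of geodesics under quasi-isometric embeddings *)

Lemma exp_beats_linear (A B : nat) :
  exists D0, forall D, (D0 < D)%N -> exists k, (A * D <= 2 ^ k /\ B * k < D)%N.
Proof.
have grow C : (forall k, 4 * C <= k -> C * k.+1 <= 2 ^ k)%N.
  suff base : (C * (4 * C).+1 <= 2 ^ (4 * C))%N.
    elim=> [|k IH] Ck.
      by have -> : C = 0%N by lia.
    case: (leqP (4 * C) k) => [/IH {}IH|kC].
      by move: IH; rewrite expnS; move: (2 ^ k)%N => m; nia.
    by have -> : k.+1 = (4 * C)%N by lia.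
  have c1 : (C.+1 <= 2 ^ C)%N by apply: ltn_expl.
  (* It suffices that C (4C + 1) <= (C + 1)^4. *)
  have -> : (2 ^ (4 * C) = (2 ^ C) ^ 4)%N by rewrite -expnM mulnC.
  apply: (@leq_trans (C.+1 ^ 4)); last by rewrite leq_exp2r.
  by rewrite !expnS expn0; nia.
exists (B.+1 * (4 * (A * B.+1)).+1)%N => D D0.
(* This k is the largest one with (B + 1) k < D, so that D is at most linear in k. *)
exists (D.-1 %/ B.+1)%N; have Dp : (0 < D)%N by lia.
have dm := divn_eq D.-1 B.+1; have mb : (D.-1 %% B.+1 < B.+1)%N by rewrite ltn_mod.
split; last by nia.
apply: (@leq_trans (A * B.+1 * (D.-1 %/ B.+1).+1)); first by nia.
by apply: grow; rewrite leq_divRL //; nia.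
Qed.

Section StabilityOfGeodesics.
Local Open Scope nat_scope.
Variables (L X : eqType) (eL : rel L) (eX : rel X) (f : L -> X) (C delta : nat).
Hypotheses (symL : symmetric eL) (symX : symmetric eX).
Hypothesis f_edge : forall a b, eL a b -> eX (f a) (f b).
Hypothesis f_qi : forall n a b, within eX n (f a) (f b) -> within eL (C * n + C) a b.
Hypothesis thinX : thin_triangles eX delta.

Let f_path a p : path eL a p -> path eX (f a) (map f p).
Proof. by elim: p a => //= b p IH a /andP[/f_edge-> /IH]. Qed.

Let within_f n a b : within eL n a b -> within eX n (f a) (f b).
Proof.
move=> [p [ep lp sp]]; exists (map f p).
by rewrite f_path // last_map lp size_map.
Qed.

(** Let [u] be a vertex of the geodesic [p] at the largest distance [D] from the
    image of [c].  Walking along [p] by [2 * D] to both sides of [u], then by at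
    most [D] to the image of [c], and closing up along [c] gives a path that
    stays at distance at least [D] from [u] and whose length is linear in [D].
    But [u] is at distance at most logarithmic in this length from the path, so
    [D] is bounded. *)
Lemma geodesic_near_image : exists D0, forall x c p,
  geodesic eL x c -> geodesic eX (f x) p -> last (f x) p = f (last x c) ->
  forall u, u \in f x :: p -> exists2 a, a \in x :: c & within eX D0 u (f a).
Proof.
have [D0 HD0] := exp_beats_linear (2 + 6 * C + C) delta.
exists D0 => x c p gc gp lp.
pose near D := forall u, u \in f x :: p ->
  exists2 a, a \in x :: c & within eX D u (f a).
suff [D Dle nD] : exists2 D, D <= D0 & near D.
  by move=> u /nD[a ac ua]; exists a => //; apply: within_leq ua.
have ex : exists D, `[< near D >].
  exists (size p); apply/asboolP => u /(path_mem_within symX gp.1)[ux _].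
  by exists x => //; rewrite mem_head.
case: (ex_minnP ex) => D /asboolP nD min; exists D => //.
rewrite leqNgt; apply/negP => DD; have [k [kD dk]] := HD0 D DD.
have Dp : 0 < D by lia.
have [u up far] : exists2 u, u \in f x :: p &
    forall a, a \in x :: c -> ~ within eX D.-1 u (f a).
  apply: contrapT => nf; suff : D <= D.-1 by lia.
  apply: min; apply/asboolP => u up; apply: contrapT => na; apply: nf.
  by exists u => // a ac wa; apply: na; exists a.
(* From a vertex [y] of [p] that is far from [u] or in the image of [c], one
   reaches the image of [c] while keeping away from [u]. *)
have detour y : y \in f x :: p ->
    (exists2 a, a \in x :: c & y = f a) \/ ~ within eX (2 * D).-1 u y ->
    exists a s, [/\ a \in x :: c, path eX y s, last y s = f a, size s <= D &
      forall v, v \in y :: s -> ~ within eX D.-1 u v].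
  move=> yp [[a ac ->]|yfar].
    exists a, [::]; split=> // v; rewrite inE => /eqP->; exact: far.
  have [a ac [s [es ls ss]]] := nD y yp; exists a, s; split=> // v vs uv.
  apply: yfar; have [vy _] := path_mem_within symX es vs.
  by apply: within_leq (within_trans uv vy); lia.
move: (up) nD detour gp lp; case/splitPl: up => p1 p2 lu up nD detour gp lp.
have [y [pa [pb [p1E ly spb [a [s [ac es ls ss sfar]]]]]]] :
    exists y pa pb, [/\ p1 = pa ++ pb, last (f x) pa = y, size pb <= 2 * D &
      exists a s, [/\ a \in x :: c, path eX y s, last y s = f a, size s <= D &
      forall v, v \in y :: s -> ~ within eX D.-1 u v]].
  case: (leqP (size p1) (2 * D)) => sp1.
    exists (f x), [::], p1; split=> //; apply: detour; first exact: mem_head.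
    by left; exists x; rewrite // mem_head.
  pose j := size p1 - 2 * D; exists (last (f x) (take j p1)), (take j p1), (drop j p1).
  have sd : size (drop j p1) = 2 * D by rewrite size_drop /j; lia.
  split=> //; [by rewrite cat_take_drop | by rewrite sd | apply: detour].
    by rewrite -{2}(cat_take_drop j p1) -!catA -cat_cons mem_cat mem_last.
  right=> /(within_sym symX); rewrite -lu -{2}(cat_take_drop j p1) last_cat.
  have := geodesic_catl gp; rewrite -{1}(cat_take_drop j p1) => /geodesic_catr gd.
  by move/(geodesic_leq gd); rewrite sd; lia.
have [z [qa [qb [p2E lz sqa [b [t [bc et lt st tfar]]]]]]] :
    exists z qa qb, [/\ p2 = qa ++ qb, last u qa = z, size qa <= 2 * D &
      exists b t, [/\ b \in x :: c, path eX z t, last z t = f b, size t <= D &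
      forall v, v \in z :: t -> ~ within eX D.-1 u v]].
  case: (leqP (size p2) (2 * D)) => sp2.
    exists (last u p2), p2, [::]; rewrite cats0; split=> //; apply: detour.
      by rewrite -lu -last_cat mem_last.
    by left; exists (last x c); rewrite ?mem_last // -lp last_cat lu.
  pose j := 2 * D; exists (last u (take j p2)), (take j p2), (drop j p2).
  have sd : size (take j p2) = 2 * D by rewrite size_take /j; case: ltnP; lia.
  split=> //; [by rewrite cat_take_drop | by rewrite sd | apply: detour].
    rewrite -lu -last_cat -{2}(cat_take_drop j p2) catA -cat_cons mem_cat.
    by rewrite mem_last.
  right; have := geodesic_catr gp; rewrite lu -{1}(cat_take_drop j p2).
  by move=> /geodesic_catl gd /(geodesic_leq gd); rewrite sd; lia.
have gyz : geodesic eX y (pb ++ qa).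
  move: gp; rewrite p1E p2E -catA => /geodesic_catr; rewrite ly catA.
  exact: geodesic_catl.
have lpb : last y pb = u by rewrite -ly -last_cat -p1E.
have [m [gm lm mc]] := geodesic_between symL gc ac bc.
have sm : size m <= C * (6 * D) + C.
  apply: (geodesic_leq gm); rewrite lm; apply: f_qi.
  have w1 : within eX D (f a) y.
    by apply: within_sym => //; exists s; split.
  have w2 : within eX (size (pb ++ qa)) y z.
    by exists (pb ++ qa); rewrite last_cat lpb lz; split=> //; case: gyz.
  have w3 : within eX D z (f b) by exists t; split.
  apply: within_leq (within_trans (within_trans w1 w2) w3).
  by rewrite size_cat; lia.
have [t' [et' lt' st' tt']] := walk_rev symX et; rewrite lt in et' lt' tt'.
pose w := s ++ map f m ++ t'.
have ew : path eX y w.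
  by rewrite !cat_path es ls f_path ?last_map ?lm ?et' //; case: gm.
have lw : last y (pb ++ qa) = last y w.
  by rewrite !last_cat ls last_map lm lt' lpb.
have sw : size w <= 2 ^ k.
  by apply: leq_trans kD; rewrite !size_cat size_map st'; nia.
have uyz : u \in y :: pb ++ qa by rewrite -cat_cons mem_cat -lpb mem_last.
have [v vw uv] := geodesic_near_path thinX ew sw gyz lw uyz.
have {}uv : within eX D.-1 u v by apply: within_leq uv; lia.
move: vw; rewrite -cat_cons mem_cat => /orP[/sfar //|].
rewrite mem_cat => /orP[/mapP[v' v'm vE]|vt].
  by apply: (far v'); rewrite -?vE //; apply: mc; rewrite inE v'm orbT.
by apply: (tfar v) => //; rewrite -tt' inE vt orbT.
Qed.

(** The vertices of [p] are close to the image of the part of [c] before [a], or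
    to that of the part after [a].  Where [p] passes from one to the other, it
    comes close to two vertices of [c] on both sides of [a]; these are close to
    each other, so [a], which lies on the geodesic between them, is close
    too. *)
Lemma image_near_geodesic : exists D1, forall x c p,
  geodesic eL x c -> geodesic eX (f x) p -> last (f x) p = f (last x c) ->
  forall a, a \in x :: c -> exists2 w, w \in f x :: p & within eX D1 (f a) w.
Proof.
have [D0 HD0] := geodesic_near_image.
exists (C * (D0 + 1 + D0) + C + D0) => x c p gc gp lp a ac.
have nearp := HD0 x c p gc gp lp; move: nearp gc lp; case/splitPl: ac => c1 c2 la nearp gc lp.
pose close (c' : seq L) w := exists2 b, b \in c' & within eX D0 w (f b).
have [w [w' [wp [b bc1 wb] [b' bc2 wb'] ww']]] :
    exists w w', [/\ w \in f x :: p, close (x :: c1) w, close (a :: c2) w' &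
                     within eX 1 w w'].
  apply: path_crossing gp.1 _ _ _.
  - move=> u /nearp[b]; rewrite -cat_cons mem_cat => /orP[] bc ub.
      by left; exists b.
    by right; exists b; rewrite // inE bc orbT.
  - by exists x; [rewrite mem_head | apply: within_refl].
  - exists (last x (c1 ++ c2)); first by rewrite last_cat la mem_last.
    by rewrite lp; apply: within_refl.
have wbb' : within eX (D0 + 1 + D0) (f b) (f b').
  apply: within_trans wb'; apply: within_trans ww'.
  exact: within_sym.
have bX := f_qi wbb'; exists w => //.
move: la gc bX wb; case/splitPl: bc1 => a1 a2 lb la gc.
case/splitPl: bc2 gc => b1 b2 lb' gc bX wb.
move: gc; rewrite -catA => /geodesic_catr; rewrite lb catA => /geodesic_catl g.
have la' : last b a2 = a by rewrite -la last_cat lb.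
have := geodesic_leq g; rewrite last_cat la' lb' => /(_ _ bX) sz.
have ab : within eX (C * (D0 + 1 + D0) + C) (f a) (f b).
  apply: within_sym => //; apply: within_f; exists a2.
  by split; [case: (geodesic_catl g) | | move: sz; rewrite size_cat; lia].
by apply: within_trans ab _; apply: within_sym.
Qed.

Lemma thin_triangles_pullback : (forall a b, exists n, within eL n a b) ->
  exists delta', thin_triangles eL delta'.
Proof.
move=> conn; have [D0 H0] := geodesic_near_image.
have [D1 H1] := image_near_geodesic.
exists (C * (D1 + delta + D0) + C) => x y z p q r gp lp gq lq gr lr u ur.
have geoX a b : exists s, geodesic eX (f a) s /\ last (f a) s = f b.
  have [n /within_f ab] := conn a b; exact: geodesic_exists ab.
have [P [gP lP]] := geoX x y; have [Q [gQ lQ]] := geoX y z.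
have [T [gT lT]] := geoX x z.
have [u' u'T uu'] := H1 x r T gr gT ltac:(by rewrite lr) u ur.
have [w' w'PQ uw'] := thinX gP lP gQ lQ gT lT u'T.
have [w wpq w'w] : exists2 w, (w \in x :: p) || (w \in y :: q) &
    within eX D0 w' (f w).
  case/orP: w'PQ => [/(H0 x p P gp gP)|/(H0 y q Q gq gQ)].
    by rewrite lp => /(_ lP)[w wp ww]; exists w => //; rewrite wp.
  by rewrite lq => /(_ lQ)[w wp ww]; exists w => //; rewrite wp orbT.
exists w => //; apply: f_qi; apply: within_trans w'w.
exact: within_trans uw'.
Qed.

End StabilityOfGeodesics.

(** * Finite collections *)

Lemma uniform_bound (A : eqType) (s : seq A) (Q : A -> nat -> Prop) :
  (forall x m n, (m <= n)%N -> Q x m -> Q x n) ->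
  (forall x, x \in s -> exists n, Q x n) ->
  exists n, forall x, x \in s -> Q x n.
Proof.
move=> mono; elim: s => [|x s IH] Qs; first by exists 0%N.
have [n Qn] := IH (fun y ys => Qs y (@mem_behead _ (x :: s) y ys)).
have [m Qm] := Qs x (mem_head x s).
exists (maxn m n) => y; rewrite inE => /predU1P[->|ys].
  exact: mono (leq_maxl _ _) Qm.
exact: mono (leq_maxr _ _) (Qn y ys).
Qed.

Lemma finite_image_representatives (A B : eqType) (P : set A) (f : A -> B) :
  finite_set (f @` P) ->
  exists s : seq A, forall x, P x -> exists2 y, y \in s & P y /\ f y = f x.
Proof.
move=> /finite_seqP[t tE].
have sub y : y \in t -> exists2 x, P x & f x = y.
  by move=> yt; have : (f @` P) y by rewrite tE.
suff [s Hs] : exists s : seq A, forall y, y \in t -> exists2 x, x \in s & P x /\ f x = y.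
  exists s => x Px; apply: Hs; have : (f @` P) (f x) by exists x.
  by rewrite tE.
elim: t sub {tE} => [|y t IH] sub; first by exists [::].
have [x Px fx] := sub y (mem_head y t).
have [s Hs] := IH (fun z zt => sub z (@mem_behead _ (y :: t) z zt)).
exists (x :: s) => z; rewrite inE => /predU1P[->|/Hs[w ws Pw]].
  by exists x; rewrite ?mem_head.
by exists w; rewrite // inE ws orbT.
Qed.

(** * Word lengths *)

Section RelativeWords.
Local Open Scope group_scope.
Variables (G : groupType) (T : set G).
Implicit Types (g x y : G) (m n : nat).

Lemma within_cayley_mul g n x y :
  within (cayley T) n x y -> within (cayley T) n (g * x) (g * y).
Proof.
move=> [p [ep <- sp]]; exists (map (fun y => g * y) p).
rewrite last_map size_map; split=> //; rewrite path_map.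
move: ep; apply: sub_path => a b; rewrite /cayley /=.
by rewrite (inj_eq (@mulgI _ g)) invgM -mulgA mulKg.
Qed.

Lemma within_cayleyE n x y :
  within (cayley T) n x y <-> within (cayley T) n 1 (x^-1 * y).
Proof.
split=> [/(within_cayley_mul x^-1)|/(within_cayley_mul x)].
  by rewrite mulVg.
by rewrite mulg1 mulVKg.
Qed.

Lemma within_cayley_prod m n x y : within (cayley T) m 1 x ->
  within (cayley T) n 1 y -> within (cayley T) (m + n) 1 (x * y).
Proof.
move=> wx wy; apply: within_trans wx _.
by have := within_cayley_mul x wy; rewrite mulg1.
Qed.

Hypothesis Tinv : forall x, T x -> T x^-1.

Lemma cayley_sym : symmetric (cayley T).
Proof.
move=> x y; rewrite /cayley /= eq_sym; congr (_ && _).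
by apply/idP/idP; rewrite !in_setE => /Tinv; rewrite invgM invgK.
Qed.

Lemma generates_within : generates (T `|` [set 1]) ->
  forall g, exists n, within (cayley T) n 1 g.
Proof.
move=> gen g; suff : g \in [pred x | `[< exists n, within (cayley T) n 1 x >]].
  by move=> /asboolP.
apply: gen => [|x [Tx|->]]; last 2 first.
- apply/asboolP; case: (eqVneq x 1) => [->|x1]; first by exists 0%N; apply: within_refl.
  exists 1%N, [:: x]; split=> //=; rewrite /cayley /= eq_sym x1 invg1 mul1g andbT /=.
  by rewrite in_setE.
- by apply/asboolP; exists 0%N; apply: within_refl.
split; first by apply/asboolP; exists 0%N; apply: within_refl.
move=> x y /asboolP[m wx] /asboolP[n wy]; apply/asboolP; exists (m + n)%N.
apply: within_cayley_prod => //; apply: (within_sym cayley_sym).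
by apply/within_cayleyE; rewrite invgK mulg1.
Qed.

End RelativeWords.

(** * Actions on graphs *)

Section GraphActions.
Local Open Scope group_scope.
Variables (G : groupType) (V : eqType) (e : rel V) (act : G -> V -> V).
Hypothesis act_e : graph_action e act.

Lemma graph_act1 v : act 1 v = v. Proof. by case: act_e. Qed.
Lemma graph_actM g h v : act (g * h) v = act g (act h v).
Proof. by case: act_e. Qed.
Lemma graph_actE g x y : e (act g x) (act g y) = e x y.
Proof. by case: act_e. Qed.

Lemma graph_actK g : cancel (act g) (act g^-1).
Proof. by move=> v; rewrite -graph_actM mulVg graph_act1. Qed.

Lemma path_act g x p : path e x p -> path e (act g x) (map (act g) p).
Proof. by rewrite path_map; apply: sub_path => a b /=; rewrite graph_actE. Qed.

Lemma vertex_stabilizer_act g v :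
  vertex_stabilizer act (act g v) = conj_set g (vertex_stabilizer act v).
Proof.
rewrite /vertex_stabilizer /conj_set; apply/seteqP; split=> x /=.
  move=> xg; exists (g^-1 * x * g); first by rewrite !graph_actM xg graph_actK.
  by rewrite !mulgA mulgV mul1g mulgK.
by move=> [y yv <-]; rewrite !graph_actM graph_actK yv.
Qed.

Lemma vertex_stabilizerV v x :
  vertex_stabilizer act v x -> vertex_stabilizer act v x^-1.
Proof. by rewrite /vertex_stabilizer /= => {1}<-; rewrite graph_actK. Qed.

Section RelativeLengths.
Variables (PP : set (set G)) (T : set G).
Hypothesis PPrep : conj_representatives PP (infinite_vertex_stabilizers act).
Hypothesis PPT : parabolic_elements PP `<=` T.
Hypothesis Tgen : forall g, exists n, within (cayley T) n 1 g.

(** A stabilizer is finite or conjugate to a member of [PP], whose nontrivial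
    elements have length one. *)
Lemma vertex_stabilizer_bounded v :
  exists n, forall g, act g v = v -> within (cayley T) n 1 g.
Proof.
have [fin|inf] := pselect (finite_set (vertex_stabilizer act v)).
  have [s sE] := (finite_seqP _).1 fin.
  have [] := @uniform_bound _ s (fun g n => within (cayley T) n 1 g).
  - by move=> x m n; apply: within_leq.
  - by move=> x _; apply: Tgen.
  move=> n Hn; exists n => g gv; apply: Hn.
  by have : vertex_stabilizer act v g by []; rewrite sE.
have [|P [[PPP [c _ cE]] _]] := PPrep.2 (vertex_stabilizer act v).
  by split=> //; exists v.
have [m cm] := Tgen c; have [n cn] := Tgen c^-1.
exists (m + 1 + n)%N => g gv; have : vertex_stabilizer act v g by [].
rewrite -cE => -[x Px <-]; apply: within_cayley_prod => //.
apply: within_cayley_prod => //.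
case: (eqVneq x 1) => [->|x1]; first exact: within_refl.
exists [:: x]; split=> //=; rewrite /cayley /= eq_sym x1 invg1 mul1g andbT /= in_setE.
by apply: PPT; split; [apply/eqP | exists P].
Qed.

(** The elements that move [u] to [u'] form a coset of the stabilizer of [u]. *)
Lemma transporter_bounded (U : seq V) : exists n, forall u u' g,
  u \in U -> u' \in U -> act g u = u' -> within (cayley T) n 1 g.
Proof.
have [] := @uniform_bound _ [seq (u, u') | u <- U, u' <- U]
    (fun u n => forall g, act g u.1 = u.2 -> within (cayley T) n 1 g).
- by move=> u m n mn H g /H; apply: within_leq.
- move=> [u u'] _ /=.
  have [[g0 g0u]|none] := pselect (exists g0, act g0 u = u').
    have [m g0m] := Tgen g0; have [n Hn] := vertex_stabilizer_bounded u.
    exists (m + n)%N => g gu; rewrite -(mulVKg g0 g).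
    apply: within_cayley_prod => //; apply: Hn.
    by rewrite graph_actM gu -g0u graph_actK.
  by exists 0%N => g gu; case: none; exists g.
move=> n Hn; exists n => u u' g uU u'U; apply: (Hn (u, u')).
by apply: allpairs_f.
Qed.

(** Each edge of a path from [v0] to [g v0] lies in a translate [g_i U], and
    consecutive translates share a vertex.  So [g_i^-1 g_(i+1)] moves one vertex
    of [U] to another, and has bounded relative length. *)
Lemma relative_length_le_orbit_distance (U : seq V) v0 : v0 \in U ->
  (forall x y, e x y -> exists g a b,
     [/\ a \in U, b \in U, x = act g a & y = act g b]) ->
  exists N, forall n g, within e n v0 (act g v0) ->
    within (cayley T) (N * n.+1) 1 g.
Proof.
move=> v0U cover; have [N HN] := transporter_bounded U; exists N.
suff walk g p x h u : u \in U -> x = act h u -> path e x p ->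
    last x p = act g v0 -> within (cayley T) (N * (size p).+1) h g.
  move=> n g [p [ep lp sp]]; apply: within_leq (walk g p v0 1 v0 _ _ ep lp) => //.
    by rewrite leq_mul2l ltnS sp orbT.
  by rewrite graph_act1.
elim: p x h u => [|y p IH] x h u uU xE /=.
  move=> _ lp; apply/within_cayleyE; rewrite muln1.
  by apply: (HN v0 u) => //; rewrite graph_actM -lp xE graph_actK.
move=> /andP[/cover[k [a [b [aU bU xE' yE]]]] yp] lp.
rewrite mulnS; apply: within_trans (IH y k b bU yE yp lp).
apply/within_cayleyE; apply: (HN a u) => //.
by rewrite graph_actM -xE' xE graph_actK.
Qed.

End RelativeLengths.

Lemma edge_orbit_representatives : finite_set (edge_orbit act @` edges e) ->
  exists U : seq V, forall x y, e x y -> exists g a b,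
     [/\ a \in U, b \in U, x = act g a & y = act g b].
Proof.
move=> fin; pose f (u : V * V) := edge_orbit act [set u.1; u.2].
have [|s Hs] := @finite_image_representatives _ _ [set u | e u.1 u.2] f.
  apply: sub_finite_set fin => _ [u eu <-].
  by exists [set u.1; u.2] => //; exists u.1, u.2.
exists (map fst s ++ map snd s) => x y exy.
have [[a b] ms [_ fab]] := Hs (x, y) exy.
have : f (x, y) [set x; y].
  exists 1 => //; apply/seteqP; split=> z /=.
    by move=> [w ww <-]; rewrite graph_act1.
  by move=> zz; exists z; rewrite // graph_act1.
rewrite -fab => -[g _ gE].
have as_ : a \in map fst s ++ map snd s by rewrite mem_cat (map_f fst ms).
have bs : b \in map fst s ++ map snd s by rewrite mem_cat (map_f snd ms) orbT.
have orb z : z \in [set x; y] -> exists2 c, c \in map fst s ++ map snd s & z = act g c.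
  rewrite -gE in_setE => -[c [->|->] <-]; by [exists a | exists b].
have [c cs xE] := orb x (mem_set (or_introl erefl)).
have [d ds yE] := orb y (mem_set (or_intror erefl)).
by exists g, c, d.
Qed.

Lemma finite_transporter_at_edge v u u' :
  (forall E, edges e E -> finite_set (edge_stabilizer act E)) -> e v u ->
  finite_set [set g | act g v = v /\ act g u = u'].
Proof.
move=> fin evu.
have [[h [hv hu]]|none] := pselect (exists h, act h v = v /\ act h u = u'); last first.
  by apply: sub_finite_set (finite_set0 G) => g gP; case: none; exists g.
have efin : finite_set (edge_stabilizer act [set v; u]).
  by apply: fin; exists v, u.
apply: sub_finite_set (finite_image (fun k => h * k) efin) => g [gv gu].
exists (h^-1 * g); last by rewrite mulVKg.
have kv : act (h^-1 * g) v = v by rewrite graph_actM gv -{1}hv graph_actK.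
have ku : act (h^-1 * g) u = u by rewrite graph_actM gu -hu graph_actK.
apply/seteqP; split=> z /=.
  by move=> [w [->|->] <-]; rewrite ?kv ?ku; [left | right].
by move=> [->|->]; [exists v; rewrite ?kv; [left|] | exists u; rewrite ?ku; [right|]].
Qed.

End GraphActions.

(** A path from [u] to [u'] that avoids [v] can be made simple, and then closes
    up to a circuit through the edge between [v] and [u].  Fineness thus bounds
    the number of directions at [v] that are reached from [u] by a short path
    avoiding [v]. *)
Lemma finite_neighbours_by_detours (V : eqType) (e : rel V) v u m :
  fine_graph e -> symmetric e -> e v u ->
  finite_set [set u' | e v u' /\ exists p, [/\ path e u p, last u p = u',
                                       (size p <= m)%N & v \notin u :: p]].
Proof.
move=> fine es evu.
have edge : edges e [set v; u] by exists v, u.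
pose C n := [set c : seq V | circuit e n c /\ circuit_edge c [set v; u]].
apply: (@sub_finite_set _ _ ([set u] `|`
   \bigcup_(n in `I_(m.+3)) \bigcup_(c in C n) [set` c])); last first.
  rewrite finite_setU; split; first exact: finite_set1.
  apply: bigcup_finite => [|n _]; first exact: finite_II.
  by apply: bigcup_finite => [|c _]; [apply: fine | apply: finite_seq].
move=> u' [evu' [p [ep lp sp vp]]].
case: (eqVneq u' u) => [->|neq]; [by left | right].
move: lp; case/shortenP: ep => q eq uq qp lq.
have sq : (size q <= size p)%N.
  by apply: uniq_leq_size qp; case/andP: uq.
have vq : v \notin u :: q.
  by apply: contra vp; rewrite !inE => /orP[->//|/qp ->]; rewrite orbT.
have q0 : (0 < size q)%N by case: q lq {eq uq qp sq vq} => //= E; rewrite E eqxx in neq.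
exists (size q).+2; first by rewrite /=; lia.
exists (v :: u :: q); last by rewrite /= -lq inE mem_last orbT.
split; last by exists v; rewrite ?mem_head //= eqxx.
split=> //; last by rewrite cons_uniq vq.
by rewrite /= evu rcons_path eq lq es.
Qed.

(** * The hull of an orbit *)

Lemma paths_in_finite_set (V : eqType) (e : rel V) (v0 : V) (W : seq V) :
  graph_connected e -> exists (F : seq V) (M : nat), v0 \in F /\
    forall w, w \in W -> exists p, [/\ path e v0 p, last v0 p = w,
                                       (size p <= M)%N & {subset p <= F}].
Proof.
move=> [_ conn]; elim: W => [|w W [F [M [v0F IH]]]].
  by exists [:: v0], 0%N; rewrite mem_head.
have [p ep lp] := conn v0 w; exists (F ++ p), (maxn M (size p)).
rewrite mem_cat v0F; split=> // z; rewrite inE => /predU1P[->|/IH[q [eq lq sq qF]]].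
  by exists p; split=> //; [rewrite leq_maxr | move=> y yp; rewrite mem_cat yp orbT].
exists q; split=> //; first by rewrite (leq_trans sq) ?leq_maxl.
by move=> y yq; rewrite mem_cat qF.
Qed.

Lemma valV (G : groupType) (D : pred G) (H : subGroupType D) (h : H) :
  val (h^-1)%g = ((val h)^-1)%g.
Proof. exact: gmulfV. Qed.

Section Hull.
Local Open Scope group_scope.
Variables (G : groupType) (D : pred G) (H : subGroupType D).
Variables (V : eqType) (e : rel V) (act : G -> V -> V).
Hypotheses (graph_e : simple_graph e) (act_e : graph_action e act).
Variables (F : seq V) (v0 : V).
Implicit Types (h k : H) (x y : V).

(** Pairs of vertices are required to lie in one common translate of [F]: the
    subgraph of [e] induced on the union of all translates may have infinitely
    many orbits of edges. *)
Definition hull_edge : rel V := [rel x y | e x y && `[< exists h a b,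
  [/\ a \in F, b \in F, x = act (val h) a & y = act (val h) b] >]].

(** Taking the connected component of [v0] makes the hull connected by
    construction; its invariance under [H] is then equivalent to the
    connectedness of the orbit of [v0] in [hull_edge]. *)
Definition in_hull : pred V := [pred x |
  `[< exists p, path hull_edge v0 p /\ last v0 p = x >]].

Lemma hull_edge_sym : symmetric hull_edge.
Proof.
move=> x y; rewrite /hull_edge /= graph_e.1; congr (_ && _).
by apply/asboolP/asboolP => -[h [a [b [aF bF xE yE]]]]; exists h, b, a.
Qed.

Lemma hull_edge_sub x y : hull_edge x y -> e x y.
Proof. by case/andP. Qed.

Lemma hull_edge_act h x y : hull_edge x y -> hull_edge (act (val h) x) (act (val h) y).
Proof.
move=> /andP[exy /asboolP[k [a [b [aF bF xE yE]]]]].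
rewrite /hull_edge /= (graph_actE act_e) exy /=; apply/asboolP; exists (h * k), a, b.
by rewrite xE yE valM !(graph_actM act_e).
Qed.

Lemma within_hull_act n h x y :
  within hull_edge n x y -> within hull_edge n (act (val h) x) (act (val h) y).
Proof.
move=> [p [ep <- sp]]; exists (map (act (val h)) p).
rewrite last_map size_map; split=> //; rewrite path_map.
by move: ep; apply: sub_path => a b; apply: hull_edge_act.
Qed.

Lemma path_in_finite_set_hull x p : x \in F -> {subset p <= F} ->
  path e x p -> path hull_edge x p.
Proof.
elim: p x => //= y p IH x xF pF /andP[exy yp]; have yF := pF y (mem_head y p).
rewrite IH // ?andbT; last by move=> z zp; apply: pF; rewrite inE zp orbT.
rewrite /hull_edge /= exy; apply/asboolP; exists 1, x, y.
by rewrite val1 !(graph_act1 act_e).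
Qed.

Lemma in_hull_step x y : in_hull x -> hull_edge x y -> in_hull y.
Proof.
move=> /asboolP[p [ep <-]] xy; apply/asboolP; exists (rcons p y).
by rewrite rcons_path ep xy last_rcons.
Qed.

Lemma in_hull_path x p : in_hull x -> path hull_edge x p ->
  forall y, y \in x :: p -> in_hull y.
Proof.
elim: p x => [|z p IH] x xh /=; first by move=> _ y; rewrite inE => /eqP->.
move=> /andP[xz zp] y; rewrite inE => /predU1P[->//|].
by apply: IH zp y; apply: in_hull_step xz.
Qed.

Lemma in_hull0 : in_hull v0.
Proof. by apply/asboolP; exists [::]. Qed.

Hypothesis hull_orbit : exists C, forall n h, within e n v0 (act (val h) v0) ->
  within hull_edge (C * n + C) v0 (act (val h) v0).
Hypothesis conn_e : graph_connected e.

Lemma in_hull_orbit h : in_hull (act (val h) v0).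
Proof.
have [C HC] := hull_orbit; have [p ep lp] := conn_e.2 v0 (act (val h) v0).
have [] := HC (size p) h; first by rewrite -lp; apply: path_within.
by move=> q [eq lq _]; apply/asboolP; exists q.
Qed.

Lemma in_hull_act h x : in_hull x -> in_hull (act (val h) x).
Proof.
move=> /asboolP[p [ep <-]]; rewrite -last_map.
apply: (in_hull_path (in_hull_orbit h)); last exact: mem_last.
by rewrite path_map; apply: sub_path ep => a b; apply: hull_edge_act.
Qed.

(** An element of the stabilizer moves the first edge [u] of a simple path from
    [x] to [v0] to an edge reached from [u] by a detour that goes through the
    hull and hence avoids [x].  The length of the detour is bounded uniformly,
    so there are finitely many such edges, and edge stabilizers are finite. *)
Lemma finite_stabilizer_outside_hull x : fine_graph e ->
  (forall E, edges e E -> finite_set (edge_stabilizer act E)) ->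
  ~~ in_hull x -> finite_set [set h : H | act (val h) x = x].
Proof.
move=> fine efin xh; have [C HC] := hull_orbit.
have [p0 ep0 lp0] := conn_e.2 x v0.
move: lp0; case/shortenP: ep0 => p ep up _ {p0} lp.
case: p ep up lp => [|u p]; first by move=> _ _ /= E; rewrite E in_hull0 in xh.
move=> /= /andP[exu ep] /andP[xup _] lp.
have es := graph_e.1.
pose m := (size p + (C * ((size p).+1 + (size p).+1) + C) + size p)%N.
have nfin := finite_neighbours_by_detours m fine es exu.
apply: (@sub_finite_set _ _ (val @^-1` (\bigcup_(u' in [set u' | e x u' /\
     exists p, [/\ path e u p, last u p = u', (size p <= m)%N & x \notin u :: p]])
   [set g | act g x = x /\ act g u = u']))); last first.
  apply: finite_preimage => [h k _ _|]; first exact: val_inj.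
  apply: bigcup_finite => [|u' _]; first exact: nfin.
  exact: (finite_transporter_at_edge act_e u' efin exu).
move=> h /= hx; exists (act (val h) u) => //.
split; first by rewrite -{1}hx graph_actE.
have wx : within e ((size p).+1 + (size p).+1) v0 (act (val h) v0).
  apply: (@within_trans _ _ _ _ _ x).
    apply: within_sym => //; exists (u :: p); split=> //=; first by rewrite exu.
  have exp : path e x (u :: p) by rewrite /= exu.
  have := path_act act_e (val h) exp; rewrite hx => exh.
  exists (map (act (val h)) (u :: p)); split; rewrite ?size_map //.
  by rewrite -{1}hx last_map /= lp.
have [q [eq lq sq]] := HC _ _ wx.
have [r [er lr sr rp]] := walk_rev es (path_act act_e (val h) ep).
rewrite last_map lp in er lr rp.
exists (p ++ q ++ r); split.
- rewrite !cat_path ep lp lq er andbT /=.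
  by apply: sub_path eq => a b; apply: hull_edge_sub.
- by rewrite !last_cat lp lq lr.
- by rewrite !size_cat sr size_map /m; lia.
rewrite -cat_cons !mem_cat negb_or xup negb_or /=; apply/andP; split=> //.
  apply: contra xh => xq; apply: (in_hull_path in_hull0 eq).
  by rewrite inE xq orbT.
apply/negP => xr; have : x \in act (val h) u :: map (act (val h)) p.
  by rewrite -rp inE xr orbT.
rewrite -map_cons => /mapP[y yp xE]; case/negP: xup.
have -> : x = y by rewrite -[y](graph_actK act_e (val h)) -xE -{2}hx (graph_actK act_e).
exact: yp.
Qed.

Definition hull := {x : V | in_hull x}.
Definition hull_rel : rel hull := relpre val hull_edge.
Definition hull_act h (x : hull) : hull :=
  Sub (act (val h) (val x)) (in_hull_act h (valP x)).

Lemma path_hull (x : hull) p : path hull_edge (val x) p ->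
  exists q : seq hull, path hull_rel x q /\ map val q = p.
Proof.
elim: p x => [|y p IH] x /=; first by exists [::].
move=> /andP[xy yp]; have yh := in_hull_step (valP x) xy.
have [q [eq qE]] := IH (Sub y yh) yp.
by exists (Sub y yh :: q); rewrite /= qE eq andbT.
Qed.

Lemma within_hull n (x y : hull) :
  within hull_edge n (val x) (val y) -> within hull_rel n x y.
Proof.
move=> [p [/path_hull[q [eq <-]] lq sq]]; exists q; split=> //.
  by apply: val_inj; rewrite -lq last_map.
by rewrite size_map in sq.
Qed.

Lemma hull_graph : simple_graph hull_rel.
Proof.
split=> [x y|x]; first by rewrite /hull_rel /= hull_edge_sym.
by apply/negbTE/negP => /hull_edge_sub; rewrite graph_e.2.
Qed.

Lemma hull_base x : in_hull x -> exists n, within hull_edge n v0 x.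
Proof. by move=> /asboolP[p [ep <-]]; exists (size p); apply: path_within. Qed.

Lemma hull_connected_within (x y : hull) : exists n, within hull_rel n x y.
Proof.
have [m wx] := hull_base (valP x); have [n wy] := hull_base (valP y).
exists (m + n)%N; apply: within_hull; apply: within_trans wy.
exact: (within_sym hull_edge_sym).
Qed.

Lemma hull_connected : graph_connected hull_rel.
Proof.
split; first by exists (Sub v0 in_hull0).
by move=> x y; have [n [p [ep lp _]]] := hull_connected_within x y; exists p.
Qed.

Lemma hull_graph_action : graph_action hull_rel hull_act.
Proof.
split=> [x|h k x|h x y].
- by apply: val_inj; rewrite /= val1 (graph_act1 act_e).
- by apply: val_inj; rewrite /= valM (graph_actM act_e).
rewrite /hull_rel /=; apply/idP/idP; last exact: hull_edge_act.
by move=> /(hull_edge_act h^-1); rewrite valV !(graph_actK act_e).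
Qed.

Hypothesis v0F : v0 \in F.

Lemma in_hull_translate x : in_hull x -> exists h a, a \in F /\ x = act (val h) a.
Proof.
move=> /asboolP[p [ep <-]]; case/lastP: p ep => [_|p y].
  by exists 1, v0; rewrite val1 (graph_act1 act_e).
rewrite rcons_path last_rcons => /andP[_ /andP[_ /asboolP[h [a [b [_ bF _ ->]]]]]].
by exists h, b.
Qed.

(** Every vertex of the hull is in the translate of a vertex of [F] that lies in
    the hull too, so it is at bounded hull distance from the orbit of [v0]; this
    extends the estimate for the orbit to the whole hull. *)
Lemma hull_qi : exists C, forall n (x y : hull),
  within e n (val x) (val y) -> within hull_rel (C * n + C) x y.
Proof.
have [C HC] := hull_orbit.
have [M HM] : exists M, forall x, x \in F -> in_hull x -> within hull_edge M v0 x.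
  apply: (@uniform_bound _ F (fun x n => in_hull x -> within hull_edge n v0 x)).
    by move=> x m n mn Hx /Hx; apply: within_leq.
  move=> x _; have [/hull_base[n wn]|xh] := boolP (in_hull x); first by exists n.
  by exists 0%N.
have near (x : hull) : exists h, within hull_edge M (act (val h) v0) (val x).
  have [h [a [aF xE]]] := in_hull_translate (valP x).
  exists h; rewrite xE; apply: within_hull_act; apply: HM => //.
  have := in_hull_act h^-1 (valP x).
  by rewrite xE valV (graph_actK act_e).
have sub n x y : within hull_edge n x y -> within e n x y.
  move=> [p [ep lp sp]]; exists p; split=> //.
  by apply: sub_path ep => a b; apply: hull_edge_sub.
exists (C * (M + M) + C + M + M)%N => n x y wxy; apply: within_hull.
have [h hx] := near x; have [k ky] := near y.
have whk : within e (M + n + M) v0 (act (val (h^-1 * k)) v0).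
  have w : within e (M + n + M) (act (val h) v0) (act (val k) v0).
    apply: within_trans (within_trans (sub _ _ _ hx) wxy) _.
    by apply: within_sym; [exact: graph_e.1 | apply: sub].
  move: w => [p [ep lp sp]]; exists (map (act (val h^-1)) p).
  rewrite size_map -{1 2}(graph_actK act_e (val h) v0) -valV (path_act act_e) //.
  by rewrite last_map lp valM valV (graph_actM act_e).
have w' : within hull_edge (C * (M + n + M) + C) (act (val h) v0) (act (val k) v0).
  have := within_hull_act h (HC _ _ whk).
  by rewrite valM valV -(graph_actM act_e) mulVKg.
apply: within_leq (within_trans (within_trans _ w') ky).
  2: exact: (within_sym hull_edge_sym hx).
by nia.
Qed.

Lemma hull_hyperbolic : hyperbolic e -> hyperbolic hull_rel.
Proof.
move=> [delta thin]; have [C HC] := hull_qi.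
apply: (@thin_triangles_pullback _ _ hull_rel e val C delta) => //.
- exact: hull_graph.1.
- exact: graph_e.1.
- by move=> a b; apply: hull_edge_sub.
exact: hull_connected_within.
Qed.

Lemma image_val_set2 (x y : hull) : val @` [set x; y] = [set val x; val y].
Proof.
apply/seteqP; split=> z /=.
  by move=> [w [->|->] <-]; [left | right].
by move=> [->|->]; [exists x; [left|] | exists y; [right|]].
Qed.

Lemma hull_fine : fine_graph e -> fine_graph hull_rel.
Proof.
move=> fine n E [x [y [exy ->]]].
pose circuits : set (seq V) :=
  [set c | circuit e n c /\ circuit_edge c [set val x; val y]].
have fin : finite_set circuits.
  by apply: fine; exists (val x), (val y); split=> //; apply: hull_edge_sub.
apply: (@sub_finite_set _ _ ((map val : seq hull -> seq V) @^-1` circuits)); last first.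
  by apply: finite_preimage fin => c d _ _; apply: inj_map; apply: val_inj.
move=> c [[n2 sc cyc uc] [z zc zE]]; split.
  split; rewrite ?size_map ?(map_inj_uniq val_inj) //.
  rewrite cycle_map; apply: sub_cycle cyc => a b; exact: hull_edge_sub.
exists (val z); first exact: map_f.
by rewrite (next_map val_inj) // -image_val_set2 zE image_val_set2.
Qed.

Lemma hull_edge_stabilizers :
  (forall E, edges e E -> finite_set (edge_stabilizer act E)) ->
  forall E, edges hull_rel E -> finite_set (edge_stabilizer hull_act E).
Proof.
move=> fin E [x [y [exy ->]]].
have fin' : finite_set (edge_stabilizer act [set val x; val y]).
  by apply: fin; exists (val x), (val y); split=> //; apply: hull_edge_sub.
have inj : {in (val : H -> G) @^-1` (edge_stabilizer act [set val x; val y]) &, injective val}.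
  by move=> h k _ _; apply: val_inj.
apply: sub_finite_set (finite_preimage inj fin') => h hE.
have sw : act (val h) @` [set val x; val y] =
    val @` [set hull_act h z | z in [set x; y]].
  apply/seteqP; split=> _ [w ww <-].
    case: ww => ->; [exists (hull_act h x) | exists (hull_act h y)] => //.
      by exists x; first left.
    by exists y; first right.
  by case: ww => z [->|->] <-; [exists (val x); first left | exists (val y); first right].
move: sw; rewrite hE image_val_set2; exact.
Qed.

Lemma hull_edge_orbits : finite_set (edge_orbit hull_act @` edges hull_rel).
Proof.
pose O (u : V * V) := edge_orbit hull_act
   [set x : hull | val x = u.1 \/ val x = u.2].
apply: (@sub_finite_set _ _ (O @` [set` [seq (a, b) | a <- F, b <- F]])); last first.
  exact/finite_image/finite_seq.
move=> _ [_ [x [y [exy ->]]] <-].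
have /andP[_ /asboolP[h [a [b [aF bF xE yE]]]]] := exy.
exists (a, b); first by apply/allpairsP; exists (a, b).
have pairE : [set x : hull | val x = (a, b).1 \/ val x = (a, b).2] =
    hull_act h^-1 @` [set x; y].
  apply/seteqP; split=> z /=.
    move=> [za|zb]; [exists x; first by left | exists y; first by right].
      by apply: val_inj; rewrite /= xE valV (graph_actK act_e) za.
    by apply: val_inj; rewrite /= yE valV (graph_actK act_e) zb.
  by move=> [w [->|->] <-]; [left | right];
    rewrite /= ?xE ?yE valV (graph_actK act_e).
have [_ hM _] := hull_graph_action.
have imM k l (A : set hull) :
    hull_act (k * l) @` A = hull_act k @` (hull_act l @` A).
  apply/seteqP; split=> t [z].
    by move=> zA <-; exists (hull_act l z); [exists z | rewrite hM].
  by move=> [w wA <-] <-; exists w; rewrite // hM.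
rewrite /O pairE /edge_orbit; apply/seteqP; split=> _ [k _ <-] /=.
  by exists (k * h^-1); rewrite ?imM.
by exists (k * h); rewrite // -imM mulgK.
Qed.

End Hull.

(** * Orbits of relatively quasiconvex subgroups *)

Section QuasiconvexOrbits.
Local Open Scope group_scope.
Variables (R : realType) (G : groupType) (D : pred G) (H : subGroupType D).
Variables (PP : set (set G)) (V : eqType) (e : rel V) (act : G -> V -> V).
Hypotheses (graph_e : simple_graph e) (conn_e : graph_connected e).
Hypotheses (act_e : graph_action e act).
Hypothesis PPfin : finite_set PP.
Hypothesis PPrep : conj_representatives PP (infinite_vertex_stabilizers act).
Hypothesis orbits : finite_set (edge_orbit act @` edges e).

(** If [x] and [y] are consecutive vertices of the path, with [h^-1 x] and
    [k^-1 y] in [B], then [h^-1 k] is in [B S B^-1], or [x] and [y] are in one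
    coset of some [P] and move the vertex [v] stabilized by [P] to one and the
    same vertex, which is close to the [h]- and [k]-translates of [v0]. *)
Lemma cayley_path_shadow (B : seq G) (S : set G) (F : seq V) (M : nat) (v0 : V) :
  let T := S `|` parabolic_elements PP in
  v0 \in F -> S 1 ->
  (forall b s c, b \in B -> S s -> c \in B -> exists p, [/\ path e v0 p,
     last v0 p = act (b * s * c^-1) v0, (size p <= M)%N & {subset p <= F}]) ->
  (forall P, PP P -> exists v, P = vertex_stabilizer act v /\
     forall b, b \in B -> exists p, [/\ path e v0 p,
     last v0 p = act b v, (size p <= M)%N & {subset p <= F}]) ->
  forall p x (h h' : H), path (cayley T) x p ->
  (forall v, v \in x :: p -> exists k : H, (val k)^-1 * v \in B) ->
  (val h)^-1 * x \in B -> (val h')^-1 * last x p \in B ->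
  within (hull_edge H e act F) (2 * M * (size p).+1)
     (act (val h) v0) (act (val h') v0).
Proof.
move=> T v0F S1 FS FP.
have walk v (h : H) : (exists p, [/\ path e v0 p, last v0 p = v,
      (size p <= M)%N & {subset p <= F}]) ->
    within (hull_edge H e act F) M (act (val h) v0) (act (val h) v).
  move=> [p [ep lp sp pF]]; apply: within_hull_act => //; exists p; split=> //.
  exact: path_in_finite_set_hull.
have step (h k : H) b s c : b \in B -> S s -> c \in B ->
    (val h)^-1 * (val k) = b * s * c^-1 ->
    within (hull_edge H e act F) M (act (val h) v0) (act (val k) v0).
  move=> bB Ss cB hk.
  have -> : act (val k) v0 = act (val h) (act (b * s * c^-1) v0).
    by rewrite -hk -(graph_actM act_e) mulVKg.
  exact/walk/FS.
elim=> [|y p IH] x h h' /=.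
  move=> _ _ hx h'x; apply: within_leq (step h h' _ 1 _ hx S1 h'x _); first by lia.
  by rewrite mulg1 invgM invgK -mulgA mulVKg.
move=> /andP[xy yp] near hx h'l.
have [k ky] : exists k : H, (val k)^-1 * y \in B by apply: near; rewrite !inE eqxx orbT.
have {IH} := IH y k h' yp _ ky h'l => IH.
rewrite [X in within _ X](_ : _ = (M + M + 2 * M * (size p).+1)%N); last by lia.
apply: within_trans (IH _); last by move=> v vp; apply: near; rewrite inE vp orbT.
move: xy => /andP[_]; rewrite in_setE => -[Ss|[_ [P PPP Ps]]].
  apply: within_leq (step h k _ _ _ hx Ss ky _); first by lia.
  by rewrite invgM invgK !mulgA !mulgK.
have [v [PE vF]] := FP P PPP.
have xvy : act x v = act y v.
  move: Ps; rewrite PE /vertex_stabilizer /= => sv.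
  by rewrite -{1}sv -(graph_actM act_e) mulVKg.
apply: (@within_trans _ _ _ _ _ (act x v)).
  have := walk _ h (vF _ hx).
  by rewrite -(graph_actM act_e) mulVKg.
rewrite xvy; apply: within_sym; first exact: hull_edge_sym.
have := walk _ k (vF _ ky).
by rewrite -(graph_actM act_e) mulVKg.
Qed.

Lemma quasiconvex_orbit_embedding (v0 : V) :
  relatively_quasiconvex R PP [set x : G | D x] ->
  exists F : seq V, v0 \in F /\ exists C, forall n (h : H),
    within e n v0 (act (val h) v0) ->
    within (hull_edge H e act F) (C * n + C) v0 (act (val h) v0).
Proof.
move=> [S [d [kappa [Sfin [Sinv Sgen] [dmet dinv dprop] qc]]]].
set T := S `|` parabolic_elements PP in qc.
have [d0 d1 dsym _] := dmet.
have [B BE] := (finite_seqP _).1 (dprop 1 kappa).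
have inB g : ((d 1%g g) <= kappa)%R -> g \in B.
  by move=> gk; have : [set y | ((d 1%g y) <= kappa)%R] g by []; rewrite BE.
have PPinv P x : PP P -> P x -> P x^-1.
  move=> /PPrep.1[[v ->] _]; exact: (vertex_stabilizerV act_e).
have Tinv x : T x -> T x^-1.
  move=> [/Sinv Sx|[x1 [P PPP Px]]]; [by left | right].
  split; last by exists P => //; apply: PPinv.
  by move=> /eqP; rewrite invg_eq1 => /eqP.
have Tgen : forall g, exists n, within (cayley T) n 1 g.
  apply: generates_within => // K Kcl KT; apply: Sgen => // x [Sx|[P PPP Px]].
    by apply: KT; left; left.
  apply: KT; have [->|x1] := eqVneq x 1; [by right | left; right].
  by split; [apply/eqP | exists P].
have [S' S'E] := (finite_seqP _).1 Sfin.
have [vs Hvs] : exists vs : seq V, forall P, PP P ->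
    exists2 v, v \in vs & P = vertex_stabilizer act v.
  have [|vs Hvs] := @finite_image_representatives V (set G)
     [set v | PP (vertex_stabilizer act v)] (vertex_stabilizer act).
    by apply: sub_finite_set PPfin => _ [v vP <-].
  exists vs => P PPP; have [[v vE] _] := PPrep.1 P PPP.
  have [|w ws [_ wE]] := Hvs v; first by rewrite /= -vE.
  by exists w; rewrite // wE.
(* The element 1 is added to the generators to account for two elements of H
   near the same vertex of the geodesic. *)
pose W := [seq act (u.1 * u.2.1 * u.2.2^-1) v0 |
             u <- [seq (b, w) | b <- B, w <- [seq (s, c) | s <- 1 :: S', c <- B]]]
          ++ [seq act b v | b <- B, v <- vs].
have [F [M [v0F HF]]] := paths_in_finite_set v0 W conn_e.
have [U cover] := edge_orbit_representatives act_e orbits.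
have [N HN] : exists N, forall n g, within e n v0 (act g v0) ->
    within (cayley T) (N * n.+1) 1 g.
  apply: (@relative_length_le_orbit_distance G V e act act_e PP T PPrep _ Tgen (v0 :: U)).
  - by move=> x px; right.
  - exact: mem_head.
  - move=> x y /cover[g [a [b [aU bU xE yE]]]]; exists g, a, b.
    by rewrite !inE aU bU !orbT.
exists F; split=> //; exists (2 * M * N.+1)%N => n h /HN.
move=> hN; have [p [gp lp]] := geodesic_exists hN.
have sp : (size p <= N * n.+1)%N by apply: (geodesic_leq gp); rewrite lp.
have D1 : D 1 by rewrite -(val1 H); apply: valP.
have near v : v \in (1 : G) :: p -> exists k : H, (val k)^-1 * v \in B.
  move=> vp; have [||k Dk dk] := qc 1 p gp _ _ v vp; first exact: D1.
    by rewrite lp; apply: valP.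
  exists (Sub k Dk); apply: inB; rewrite SubK -(dinv k) mulg1 mulVKg.
  by rewrite dsym.
have B1 : 1 \in B.
  apply: inB; rewrite (d1 1 1).2 //.
  have [||k Dk dk] := qc 1 p gp _ _ 1 (mem_head _ _); first exact: D1.
    by rewrite lp; apply: valP.
  exact: Order.POrderTheory.le_trans (d0 1 k) dk.
have := @cayley_path_shadow B (S `|` [set 1]) F M v0 v0F _ _ _ p 1 1 h.
rewrite val1 (graph_act1 act_e) lp invg1 mul1g mulVg => /(_ _ _ _ _ near B1 B1) H1.
apply: within_leq (H1 _ _ _ _).
- rewrite addnC -mulnS -[X in (_ <= X)%N]mulnA leq_mul2l (mulSn N) addSn ltnS.
  by rewrite (leq_trans sp) ?orbT ?leq_addl.
- by right.
- move=> b s c bB Ss cB; apply: HF; rewrite mem_cat; apply/orP; left.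
  apply/mapP; exists (b, (s, c)) => //; apply/allpairsP; exists (b, (s, c)); split=> //.
  apply/allpairsP; exists (s, c); split=> //=; rewrite inE.
  case: Ss => [Ss|->]; last by rewrite eqxx.
  by move: Ss; rewrite S'E /= => ->; rewrite orbT.
- move=> P /Hvs[v vvs ->]; exists v; split=> // b bB; apply: HF.
  by rewrite mem_cat; apply/orP; right; apply/allpairsP; exists (b, v).
- apply: sub_path gp.1 => x y /andP[xy xyT]; rewrite /cayley /= xy /=.
  move: xyT; rewrite !in_setE => -[Sxy|Pxy]; [by left; left | by right].
Qed.

End QuasiconvexOrbits.

(** * Conjugacy classes of subgroups *)

Section ConjugacyClasses.
Local Open Scope group_scope.
Variable G : groupType.

Lemma conj_setM (g h : G) A : conj_set g (conj_set h A) = conj_set (g * h) A.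
Proof.
rewrite /conj_set; apply/seteqP; split=> z [x].
  by move=> [y Ay <-] <-; exists y; rewrite // invgM !mulgA.
by move=> Ax <-; exists (h * x * h^-1); [exists x | rewrite invgM !mulgA].
Qed.

Lemma conj_set1 (A : set G) : conj_set 1 A = A.
Proof.
rewrite /conj_set; apply/seteqP; split=> [_ [x Ax <-]|x Ax].
  by rewrite invg1 mulg1 mul1g.
by exists x; rewrite // invg1 mulg1 mul1g.
Qed.

Lemma conj_class_refl (A : set G) : conj_class A A.
Proof. by exists 1; rewrite // conj_set1. Qed.

Lemma conj_class_conj_set (g : G) A : conj_class (conj_set g A) = conj_class A.
Proof.
apply/seteqP; split=> _ [h _ <-]; rewrite ?conj_setM; first by exists (h * g).
by exists (h * g^-1); rewrite // conj_setM mulgVK.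
Qed.

Lemma finite_conj_representatives (O Q : set (set G)) :
  conj_representatives O Q -> finite_set (@conj_class G @` Q) -> finite_set O.
Proof.
move=> [OQ rep] Qfin.
have [|s Hs] := @finite_image_representatives (set G) (set (set G)) O (@conj_class G).
  by apply: sub_finite_set Qfin; apply: image_subset.
apply: sub_finite_set (finite_seq s) => A OA /=.
have [B Bs [OB BA]] := Hs A OA.
have [C [_ uniqC]] := rep A (OQ A OA).
have CA : C = A by apply: uniqC; split=> //; apply: conj_class_refl.
have CB : C = B by apply: uniqC; split=> //; rewrite BA; apply: conj_class_refl.
by rewrite -CA CB.
Qed.

End ConjugacyClasses.

(** * Relative hyperbolicity of quasiconvex subgroups *)

Theorem theorem9p1 (R : realType) (G : groupType) (PP : set (set G))
    (D : pred G) (H : subGroupType D)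
    (hG : relatively_hyperbolic PP)
    (hH : relatively_quasiconvex R PP [set x : G | D x]) :
  finite_set (@conj_class H @` infinite_parabolics H PP) /\
  forall O : set (set H),
    conj_representatives O (infinite_parabolics H PP) ->
    relatively_hyperbolic O.
Proof.
move: hG => [Gcount PPfin [V [e [act [[graph_e conn_e act_e]]]]]].
move=> [hyp fine efin orbits PPrep].
have [v0 _] := conn_e.1.
have [F [v0F emb]] :=
  quasiconvex_orbit_embedding H graph_e conn_e act_e PPfin PPrep orbits v0 hH.
pose HF := hull H e act F v0.
pose Hact : H -> HF -> HF := hull_act act_e emb conn_e.
have stabE x : vertex_stabilizer Hact x =
    [set h : H | vertex_stabilizer act (val x) (val h)].
  apply/seteqP; split=> h /=; first by move=> hx; rewrite /vertex_stabilizer /= -{2}hx.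
  by move=> hx; apply: val_inj.
have parabolicsE : infinite_vertex_stabilizers Hact = infinite_parabolics H PP.
  apply/seteqP; split=> A [].
    move=> [x ->] inf; split=> //; rewrite stabE.
    have [|P [[PPP [g _ gE]] _]] := PPrep.2 (vertex_stabilizer act (val x)).
      split; first by exists (val x).
      move=> fin; apply: inf; rewrite stabE; apply: finite_preimage fin.
      by move=> h k _ _; apply: val_inj.
    by exists g, P; rewrite gE.
  move=> [g [P [PPP AE]]] inf; split=> //.
  have [[v PE] _] := PPrep.1 P PPP.
  have {}AE : A = [set h : H | act (val h) (act g v) = act g v].
    by rewrite AE PE -(vertex_stabilizer_act act_e).
  have gv : in_hull H e act F v0 (act g v).
    apply: contrapT => /negP out; apply: inf; rewrite AE.
    exact: (finite_stabilizer_outside_hull graph_e act_e emb conn_e fine efin).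
  by exists (Sub (act g v) gv); rewrite stabE AE.
have classes_fin : finite_set (@conj_class H @` infinite_parabolics H PP).
  rewrite -parabolicsE.
  pose cl (a : V) := conj_class [set h : H | act (val h) a = a].
  apply: sub_finite_set (finite_image cl (finite_seq F)) => _ [_ [[x ->] _] <-].
  have [h [a [aF xE]]] := in_hull_translate act_e v0F (valP x).
  exists a => //; rewrite stabE xE (vertex_stabilizer_act act_e) /cl.
  rewrite -(conj_class_conj_set h); congr conj_class; apply/seteqP; split=> k /=.
    move=> [y ya <-]; exists (val y); first exact: ya.
    by rewrite !valM valV.
  move=> [y ya yk]; exists (h^-1 * k * h)%g.
    by rewrite /= !valM valV -yk -!mulgA mulVg mulg1 mulKg.
  by rewrite !mulgA mulgV mul1g mulgK.
split=> // O Orep; split.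
- have [f finj] := countable_injP _ Gcount.
  apply/countable_injP; exists (fun h : H => f (val h)) => h k _ _ fhk.
  by apply: val_inj; apply: finj fhk; rewrite in_setT.
- exact: finite_conj_representatives Orep classes_fin.
exists HF, (@hull_rel _ _ H _ e act F v0), Hact; split; split.
- exact: hull_graph.
- exact: hull_connected.
- exact: hull_graph_action.
- exact: hull_hyperbolic.
- exact: hull_fine.
- exact: hull_edge_stabilizers.
- exact: hull_edge_orbits.
- by rewrite parabolicsE.
Qed.
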